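(* Let $(\mathbb{X},\preceq_{\mathbb{X}})$ be a poset and let $(\mathbb{Y},\preceq_{\mathbb{Y}})$ be a complete inf-semilattice. Let $X\subset\mathbb{X}$ be a subset of $\mathbb{X}$, let $\widetilde{\mathbb{X}}\subset\mathbb{X}$ be an inf-semilattice such that $X\subset\widetilde{\mathbb{X}}\subset\mathbb{X}$, and let $\Phi:\mathbb{X}\to\mathbb{Y}$ be a mapping such that: (T1) $\Phi$ is order preserving, i.e. for all $x,x'\in\mathbb{X}$, $x\preceq_{\mathbb{X}}x'$ implies $\Phi(x)\preceq_{\mathbb{Y}}\Phi(x')$; (T2) the element $\bigwedge_{x\in X}x$ exists in the poset $\mathbb{X}$, and there exists a sequence $(x_n)_{n\in\mathbb{N}}$ in $X$ such that (a) $\bigwedge_{n\in\mathbb{N}}x_n$ exists in $\mathbb{X}$ and $\bigwedge_{n\in\mathbb{N}}x_n=\bigwedge_{x\in X}x$; (b) the nonincreasing sequence $(x'_n)_{n\in\mathbb{N}}$ in $\widetilde{\mathbb{X}}$ defined by $x'_n=\bigwedge_{k\le n}x_k$, for all $n\in\mathbb{N}$, satisfies $$\bigwedge_{n\in\mathbb{N}}\Phi(x'_n)\preceq_{\mathbb{Y}}\Phi\Big(\bigwedge_{n\in\mathbb{N}}x_n\Big)=\Phi\Big(\bigwedge_{x\in X}x\Big).$$ Then the interchange formula $$\bigwedge_{x\in X}\Phi(x)=\Phi\Big(\bigwedge_{x\in X}x\Big)$$ holds if and only if the subset $X$ is $\Phi$-inf-directed.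
   Context: A poset is a set with a reflexive, antisymmetric, transitive binary relation. The greatest lower bound of a subset $S$ of a poset, when it exists, is denoted $\bigwedge_{s\in S}s$. A poset is an inf-semilattice if every nonempty finite subset of it has a greatest lower bound; it is a complete inf-semilattice if every nonempty subset of it has a greatest lower bound. The subset $X$ is called $\Phi$-inf-directed if, for every nonempty finite subset $\tilde X\subset X$, $$\bigwedge_{x\in X}\Phi(x)\preceq_{\mathbb{Y}}\Phi\Big(\bigwedge_{x\in\tilde X}x\Big).$$ *)

(* Defs.v *)
From mathcomp Require Import all_boot all_order.
From mathcomp Require Import boolp classical_sets functions cardinality.

Set Implicit Arguments.
Unset Strict Implicit.
Unset Printing Implicit Defensive.

(* Greatest lower bounds are handled relationally, through [infimums]:
   [infimums S m] reads "the greatest lower bound of S exists and is m". *)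

Definition complete_inf_semilattice d (T : porderType d) : Prop :=
  forall S : set T, (S !=set0 -> infimums S !=set0)%classic.

(* A subset that is an inf-semilattice for the meets of the ambient poset: the
   bounds are taken in [T] and are required to belong to [A].  It is not enough
   that [A] be an inf-semilattice for the induced order, whose meets may differ
   from those of [T]. *)
Definition inf_semilattice_in d (T : porderType d) (A : set T) : Prop :=
  forall F : set T, (F `<=` A -> finite_set F -> F !=set0 ->
    exists2 m, infimums F m & A m)%classic.

Definition inf_directed d1 d2 (T1 : porderType d1) (T2 : porderType d2)
    (Phi : T1 -> T2) (X : set T1) : Prop :=
  forall F : set T1, (F `<=` X -> finite_set F -> F !=set0 ->
    exists y m, [/\ infimums (Phi @` X) y, infimums F m & (y <= Phi m)%O])%classic.

(* Main.v *)
Require Import Defs.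
From mathcomp Require Import all_boot all_order.
From mathcomp Require Import boolp classical_sets functions cardinality.

Import Order.TTheory.

Local Open Scope classical_set_scope.
Local Open Scope order_scope.

(** Monotonicity always puts [Phi infX] below [Phi @] X[. If it is the infimum, it also lies
    below]Phi m[for every finite meet]m[of points of]X[, as]infX <= m[. Conversely, directedness
    puts every lower bound of]Phi @[X] below the image of each partial meet [x' n], and the sequence
    hypothesis carries this to [Phi infX]. *)

Theorem theorem2 (d1 d2 : Order.disp_t)
    (TX : porderType d1) (TY : porderType d2)
    (TY_complete : complete_inf_semilattice TY)
    (X Xt : set TX)
    (Xt_semilattice : inf_semilattice_in Xt)
    (X_sub_Xt : X `<=` Xt)
    (Phi : TX -> TY)
    (T1 : forall x x' : TX, x <= x' -> Phi x <= Phi x')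
    (infX : TX)
    (T2_inf : infimums X infX)
    (T2_seq : exists x : nat -> TX,
      [/\ forall n, X (x n),
          infimums (range x) infX &
          exists x' : nat -> TX,
            (forall n, infimums (x @` [set k | (k <= n)%N]) (x' n)) /\
            (exists2 y, infimums (range (Phi \o x')) y & y <= Phi infX)]) :
  infimums (Phi @` X) (Phi infX) <-> inf_directed Phi X.
Proof.
have [infX_lb _] := T2_inf.
split=> [PhiX_inf F F_sub_X F_fin F_n0|X_dir].
  have F_sub_Xt : F `<=` Xt by move=> u /F_sub_X /X_sub_Xt.
  have [m m_inf _] := Xt_semilattice F F_sub_Xt F_fin F_n0.
  exists (Phi infX), m; split=> //.
  by apply/T1/m_inf.2 => u /F_sub_X /infX_lb.
split=> [_ [u Xu <-]|z z_lb]; first exact/T1/infX_lb.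
have [x [Xx _ [x' [x'_inf [y y_inf y_le]]]]] := T2_seq.
(* Since [y] is the infimum of the [Phi (x' n)], it suffices to bound [z] by each of them. *)
apply: le_trans y_le; apply: y_inf.2 => _ [n _ <-] /=.
have [||| w [m [w_inf m_inf w_le]]] := X_dir (x @` [set k | (k <= n)%N]).
- by move=> _ [k _ <-].
(* [k <= n] is [k < n.+1] up to conversion. *)
- exact: finite_image (finite_II n.+1).
- by exists (x n), n => /=.
(* The chain is [z <= w <= Phi m <= Phi (x' n)]; [m] and [x' n] are meets of the same set, so
   [m <= x' n]. *)
apply: le_trans (w_inf.2 _ z_lb) (le_trans w_le _).
exact/T1/(x'_inf n).2/m_inf.1.
Qed.
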